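(* Let $A=\sigma(R)\langle x_1,\dots,x_n\rangle$ be a skew PBW extension over a ring $R$, with associated family of endomorphisms $\Sigma$ of $R$, and suppose that $R$ is $\Sigma$-semicommutative and Baer. Then the following statements are equivalent: (1) $A$ is pm. (2) $\mathrm{Max}(A)$ is a retract of $\mathrm{Spec}(A)$. (3) $\mathrm{Spec}(A)$ is normal (not necessarily $T_1$). Moreover, when (3) holds, $\mathrm{Max}(A)$ is Hausdorff.
   Context: Rings are associative with identity; $\mathbb{N}$ includes $0$. Skew PBW extension: $A=\sigma(R)\langle x_1,\dots,x_n\rangle$ is a skew PBW extension over $R$ if (i) $R$ is a subring of $A$ with the same identity; (ii) there are $x_1,\dots,x_n\in A$ such that $A$ is a free left $R$-module with basis $\mathrm{Mon}(A):=\{x^\alpha:=x_1^{\alpha_1}\cdots x_n^{\alpha_n}\mid \alpha=(\alpha_1,\dots,\alpha_n)\in\mathbb{N}^n\}$; (iii) for each $i$ and each $r\in R\setminus\{0\}$ there is $c_{i,r}\in R\setminus\{0\}$ with $x_ir-c_{i,r}x_i\in R$; (iv) for all $1\le i,j\le n$ there is $d_{i,j}\in R\setminus\{0\}$ with $x_jx_i-d_{i,j}x_ix_j\in R+Rx_1+\cdots+Rx_n$. For such $A$, for each $i$ there are an injective ring endomorphism $\sigma_i$ of $R$ and a $\sigma_i$-derivation $\delta_i$ of $R$ (an additive map with $\delta_i(rs)=\sigma_i(r)\delta_i(s)+\delta_i(r)s$) such that $x_ir=\sigma_i(r)x_i+\delta_i(r)$ for all $r\in R$. Put $\Sigma:=\{\sigma_1,\dots,\sigma_n\}$,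 and for $\alpha\in\mathbb{N}^n$, $\sigma^\alpha:=\sigma_1^{\alpha_1}\circ\cdots\circ\sigma_n^{\alpha_n}$. $R$ is $\Sigma$-semicommutative if for all $a,b\in R$, $ab=0$ implies $aR\sigma^\alpha(b)=0$ for every $\alpha\in\mathbb{N}^n\setminus\{0\}$. A ring is Baer if the right (equivalently, left) annihilator of every nonempty subset is generated, as a right (respectively left) ideal, by an idempotent. A ring is pm if every prime ideal is contained in a unique maximal ideal (ideals are two-sided). $\mathrm{Spec}(A)$ is the set of prime ideals of $A$ with the Zariski topology, whose open sets are $W(I)=\{P\in\mathrm{Spec}(A)\mid I\nsubseteq P\}$ for ideals $I$ of $A$; $\mathrm{Max}(A)\subseteq\mathrm{Spec}(A)$ is the set of maximal ideals with the subspace topology. Retract: there is a continuous map $\mathrm{Spec}(A)\to\mathrm{Max}(A)$ that is the identity on $\mathrm{Max}(A)$. Normal: disjoint closed sets have disjoint open neighbourhoods. *)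

(* Defs.v *)
From HB Require Import structures.
From mathcomp Require Import all_boot all_order all_algebra.
From mathcomp Require Import all_classical all_reals all_analysis.

Set Implicit Arguments.
Unset Strict Implicit.
Unset Printing Implicit Defensive.

Import GRing.Theory.

Local Open Scope classical_set_scope.
Local Open Scope ring_scope.

(* Rings are pzRingType: associative, unital, the zero ring being allowed.    *)

Section TwoSidedIdeals.
Variable A : pzRingType.

Record two_sided_ideal (I : set A) : Prop := {
  ideal0 : I 0;
  idealB : forall a b, I a -> I b -> I (a - b);
  idealMl : forall r a, I a -> I (r * a);
  idealMr : forall r a, I a -> I (a * r) }.

(* For an ideal P, the product ideal I J is included in P if and only if all  *)
(* products a * b with a in I and b in J are in P.                            *)
Record prime_ideal (P : set A) : Prop := {
  prime_two_sided : two_sided_ideal P;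
  prime_proper : P != setT;
  prime_idealP : forall I J : set A, two_sided_ideal I -> two_sided_ideal J ->
    (forall a b, I a -> J b -> P (a * b)) -> I `<=` P \/ J `<=` P }.

Record maximal_ideal (M : set A) : Prop := {
  maximal_two_sided : two_sided_ideal M;
  maximal_proper : M != setT;
  maximal_idealP : forall J : set A,
    two_sided_ideal J -> M `<=` J -> J = M \/ J = setT }.

Definition pm_ring : Prop :=
  forall P : set A, prime_ideal P ->
    exists! M : set A, maximal_ideal M /\ P `<=` M.

Lemma idealN (I : set A) a : two_sided_ideal I -> I a -> I (- a).
Proof. by move=> II Ia; rewrite -sub0r; apply: idealB => //; apply: ideal0. Qed.

Lemma idealD (I : set A) a b : two_sided_ideal I -> I a -> I b -> I (a + b).
Proof.
by move=> II Ia Ib; rewrite -[b]opprK; apply: idealB => //; apply: idealN.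
Qed.

Lemma two_sided_idealT : two_sided_ideal [set: A].
Proof. by []. Qed.

Lemma two_sided_idealI (I J : set A) :
  two_sided_ideal I -> two_sided_ideal J -> two_sided_ideal (I `&` J).
Proof.
move=> II JI; split.
- by split; apply: ideal0.
- by move=> a b [Ia Ja] [Ib Jb]; split; apply: idealB.
- by move=> r a [Ia Ja]; split; apply: idealMl.
- by move=> r a [Ia Ja]; split; apply: idealMr.
Qed.

Definition ideal_span (X : set A) : set A :=
  [set a | forall K, two_sided_ideal K -> X `<=` K -> K a].

Lemma two_sided_ideal_span (X : set A) : two_sided_ideal (ideal_span X).
Proof.
split.
- by move=> K KI _; apply: ideal0.
- by move=> a b Xa Xb K KI XK; apply: idealB => //; [apply: Xa|apply: Xb].
- by move=> r a Xa K KI XK; apply: idealMl => //; apply: Xa.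
- by move=> r a Xa K KI XK; apply: idealMr => //; apply: Xa.
Qed.

Lemma maximal_ideal_prime (M : set A) : maximal_ideal M -> prime_ideal M.
Proof.
move=> MM; have MI := maximal_two_sided MM.
split=> //; first exact: maximal_proper.
move=> I J II JI IJM; have [|nIM] := pselect (I `<=` M); first by left.
right=> b Jb.
pose K : set A := [set c | exists2 i, I i & M (c - i)].
have KI : two_sided_ideal K.
  split.
  - by exists 0; [apply: ideal0|rewrite subr0; apply: ideal0].
  - move=> a c [i Ii Mi] [j Ij Mj]; exists (i - j); first exact: idealB.
    have -> : a - c - (i - j) = (a - i) - (c - j).
      by rewrite !opprD !opprK addrACA.
    exact: idealB.
  - move=> r a [i Ii Mi]; exists (r * i); first exact: idealMl.
    by rewrite -mulrBr; apply: idealMl.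
  - move=> r a [i Ii Mi]; exists (i * r); first exact: idealMr.
    by rewrite -mulrBl; apply: idealMr.
have [|KM|KT] := maximal_idealP MM KI.
- by move=> m Mm; exists 0; [apply: ideal0|rewrite subr0].
- case: nIM => i Ii; rewrite -KM; exists i => //.
  by rewrite subrr; apply: ideal0.
- have [i Ii Mi] : K 1 by rewrite KT.
  have -> : b = (1 - i) * b + i * b by rewrite mulrBl mul1r subrK.
  by apply: idealD => //; [apply: idealMr|apply: IJM].
Qed.

End TwoSidedIdeals.

Section Spectrum.
Variable A : pzRingType.

Record Spec : Type := MkSpec {
  spec_ideal :> set A;
  spec_prime : prime_ideal spec_ideal }.

HB.instance Definition _ := gen_eqMixin Spec.
HB.instance Definition _ := gen_choiceMixin Spec.

Definition zariskiW (I : set A) : set Spec := [set P : Spec | ~ I `<=` P].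

Definition zariski_open : set_system Spec :=
  [set U | exists2 I : set A, two_sided_ideal I & U = zariskiW I].

Lemma zariski_openT : zariski_open setT.
Proof.
exists setT; first exact: two_sided_idealT.
apply/seteqP; split=> // P _ TP.
by move/eqP: (prime_proper (spec_prime P)); apply; apply/seteqP.
Qed.

Lemma zariski_openI : setI_closed zariski_open.
Proof.
move=> _ _ [I II ->] [J JI ->].
exists (I `&` J); first exact: two_sided_idealI.
apply/seteqP; split=> P /=.
- move=> [IP JP] IJP.
  have [] // := prime_idealP (spec_prime P) II JI.
  by move=> a b Ia Jb; apply: IJP; split; [apply: idealMr|apply: idealMl].
- by move=> IJP; split=> SP; apply: IJP => a [] ? ?; apply: SP.
Qed.

Lemma zariski_open_bigU (T : Type) (f : T -> set Spec) :
  (forall t, zariski_open (f t)) -> zariski_open (\bigcup_t f t).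
Proof.
move=> fo.
pose X : set A :=
  [set a | exists t, exists I, [/\ two_sided_ideal I, f t = zariskiW I & I a]].
exists (ideal_span X); first exact: two_sided_ideal_span.
apply/seteqP; split=> P.
- move=> [t _]; have [I II ft] := fo t; rewrite ft => IP XP; apply: IP => a Ia.
  by apply: XP => K _; apply; exists t, I.
- move=> XP; apply: contrapT => nP; apply: XP => a; apply.
    exact: prime_two_sided (spec_prime P).
  move=> c [t [I [II ft Ic]]]; apply: contrapT => nPc; apply: nP.
  by exists t => //; rewrite ft => IP; apply: nPc; apply: IP.
Qed.

HB.instance Definition _ :=
  isOpenTopological.Build Spec zariski_openT zariski_openI zariski_open_bigU.

Lemma open_SpecE (U : set Spec) : open U = zariski_open U.
Proof. by []. Qed.

(* Coerced to a type, a set of points of a topological space carries the      *)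
(* subspace topology (initial topology of set_val). By maximal_ideal_prime,   *)
(* no maximal ideal is lost by quantifying over Spec.                         *)
Definition Max : set Spec := [set P : Spec | maximal_ideal P].

End Spectrum.

Definition is_retract (T : topologicalType) (B : set T) : Prop :=
  exists r : T -> B, continuous r /\ forall b : B, r (set_val b) = b.

Definition Baer (R : pzRingType) : Prop :=
  forall X : set R, X !=set0 ->
    exists2 e : R, e * e = e &
      [set r | forall a, X a -> a * r = 0] = [set e * s | s in [set: R]].

Section SkewPBW.
Variables (n : nat) (R A : pzRingType).

(* x ^ alpha = x_1 ^ alpha_1 ... x_n ^ alpha_n, in this order.                *)
Definition std_mon (x : 'I_n -> A) (alpha : {ffun 'I_n -> nat}) : A :=
  \prod_(i < n) x i ^+ alpha i.

(* The inclusion of the subring R in A is an injective morphism iota, through *)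
(* which A is a left R-module.                                                *)
Record skew_PBW (iota : {rmorphism R -> A}) (x : 'I_n -> A) : Prop := {
  pbw_inj : injective iota;
  pbw_span : forall a : A,
    exists (s : seq {ffun 'I_n -> nat}) (c : {ffun 'I_n -> nat} -> R),
      a = \sum_(alpha <- s) iota (c alpha) * std_mon x alpha;
  pbw_free : forall (s : seq {ffun 'I_n -> nat}) (c : {ffun 'I_n -> nat} -> R),
    uniq s -> \sum_(alpha <- s) iota (c alpha) * std_mon x alpha = 0 ->
    forall alpha, alpha \in s -> c alpha = 0;
  pbw_scal : forall (i : 'I_n) (r : R), r != 0 ->
    exists2 c : R, c != 0 &
      exists r0 : R, x i * iota r - iota c * x i = iota r0;
  pbw_comm : forall i j : 'I_n,
    exists2 d : R, d != 0 &
      exists (r0 : R) (r : 'I_n -> R),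
        x j * x i - iota d * x i * x j
          = iota r0 + \sum_(k < n) iota (r k) * x k }.

(* In a skew PBW extension, freeness over {1, x_i} makes the last condition   *)
(* determine sigma and delta.                                                 *)
Record pbw_data (iota : {rmorphism R -> A}) (x : 'I_n -> A)
    (sigma : 'I_n -> {rmorphism R -> R}) (delta : 'I_n -> {additive R -> R}) :
    Prop := {
  sigma_inj : forall i, injective (sigma i);
  deltaM : forall i r s,
    delta i (r * s) = sigma i r * delta i s + delta i r * s;
  pbw_dataE : forall i r,
    x i * iota r = iota (sigma i r) * x i + iota (delta i r) }.

(* sigma ^ alpha = sigma_1 ^ alpha_1 o ... o sigma_n ^ alpha_n.               *)
Definition sigma_pow (sigma : 'I_n -> R -> R) (alpha : {ffun 'I_n -> nat}) :
    R -> R :=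
  foldr (fun i f => iter (alpha i) (sigma i) \o f) id (enum 'I_n).

Definition Sigma_semicommutative (sigma : 'I_n -> R -> R) : Prop :=
  forall a b : R, a * b = 0 ->
    forall alpha : {ffun 'I_n -> nat}, alpha != [ffun=> 0%N] ->
      forall r : R, a * r * sigma_pow sigma alpha b = 0.

End SkewPBW.

(* Main.v *)
Require Import Defs.
From HB Require Import structures.
From mathcomp Require Import all_boot all_order all_algebra.
From mathcomp Require Import all_classical all_reals all_analysis.

Set Implicit Arguments.
Unset Strict Implicit.
Unset Printing Implicit Defensive.

Import GRing.Theory.

Local Open Scope classical_set_scope.
Local Open Scope ring_scope.

(** The hypotheses on R serve one purpose: they make A reduced, and for every
    reduced ring the three conditions are equivalent.

    Coefficients.  If e is idempotent, then e(1-e) = (1-e)e = 0, and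
    Sigma-semicommutativity applied to both products gives sigma_i(e) = e and
    then eR(1-e) = (1-e)Re = 0: idempotents are central and fixed by Sigma.
    In a Baer ring the annihilator of a is generated by an idempotent e, so
    ab = 0 means b = eb with ae = 0. Hence R is reduced
    ([Baer_semicomm_reduced]), and a sigma_i(b) = 0 implies ab = 0
    ([sigma_cancel0]), because sigma_i(b) = e sigma_i(b) = sigma_i(eb).

    Reducedness of A ([skew_PBW_reduced]).  Give each variable a weight, in
    such a way that every variable is lighter than any product of two
    variables. Modulo words of smaller weight, scalars pass through words by
    applying sigma's, and variables commute up to units of R: the coefficients
    d_(i,j) and d_(j,i) are inverse to each other, since R is reduced. If f has
    a single heaviest term c x^alpha, then the coefficient of x^(2 alpha) in
    f^2 is c sigma^alpha(c) times a unit, so f^2 = 0 forces c sigma^alpha(c) =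
    0, c^2 = 0 and c = 0. For a given f, the weights N^n + N^i with N large
    separate the exponents of f, so that f has a single heaviest term.

    Spectrum.  In a reduced ring, a vanishing product still vanishes after its
    factors are permuted and others are inserted. Let A be pm and let V(I),
    V(J) be disjoint closed sets. Consider the set of all s such that sy = 0
    implies aby = 0 for suitable a in 1+I and b in 1+J. It is closed under
    products; if 0 were not in it, there would be a prime ideal P disjoint from
    it, P+I and P+J would both be proper, and P would lie in two distinct
    maximal ideals. So ab = 0 for some a in 1+I and b in 1+J, and then W(a) and
    W(b) are disjoint neighbourhoods of V(I) and V(J)
    ([reduced_pm_normal]). The remaining implications hold for every ring and
    rest on two facts: an open set that contains M contains every prime below
    M, and maximal ideals are closed points. *)

(** * Normal spaces *)

(** Normality is defined by closed neighbourhoods shrinking to a closed set; the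
    complement of one closed set is a neighbourhood of the other. *)
Lemma normal_disjoint_openP (T : topologicalType) :
  normal_space T <->
  forall C D : set T, closed C -> closed D -> C `&` D = set0 ->
  exists U V, [/\ open U, open V, C `<=` U, D `<=` V & U `&` V = set0].
Proof.
split=> [nT C D cC cD CD0|sepT C cC B /set_nbhsP[W [oW CW WB]]].
- have : set_nbhs C (~` D).
    apply/set_nbhsP; exists (~` D); split=> //; first exact: closed_openC.
    exact/disjoints_subset.
  case/(nT C cC) => E /set_nbhsP[U [oU CU UE]] ED.
  exists U, (~` closure E); split=> //.
  + exact/closed_openC/closed_closure.
  + by move=> t Dt Et; apply: (ED t).
  + by rewrite -subset0 => t [Ut]; apply; apply/subset_closure/UE.
- have CW0 : C `&` ~` W = set0 by apply/disjoints_subset; rewrite setCK.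
  have [U [V [oU oV CU WV UV0]]] := sepT _ _ cC (open_closedC oW) CW0.
  exists U; first by apply/set_nbhsP; exists U; split.
  have UV : U `<=` ~` V by apply/disjoints_subset.
  apply: (subset_trans (closureS UV)).
  rewrite -(closure_id _).1; last exact: open_closedC.
  by move=> t nVt; apply: WB; apply: contrapT => nWt; apply: nVt; apply: WV.
Qed.

(** * Ideals maximal with respect to a disjointness condition *)

Section Ideals.
Variable A : pzRingType.
Implicit Types (I J K : set A).

Definition ideal_sum I J : set A := [set a | exists2 i, I i & J (a - i)].

Lemma two_sided_ideal_sum I J :
  two_sided_ideal I -> two_sided_ideal J -> two_sided_ideal (ideal_sum I J).
Proof.
move=> II JI; split.
- by exists 0; [apply: ideal0|rewrite subr0; apply: ideal0].
- move=> a b [i Ii Ji] [j Ij Jj]; exists (i - j); first exact: idealB.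
  have -> : a - b - (i - j) = (a - i) - (b - j).
    by rewrite !opprD !opprK addrACA.
  exact: idealB.
- move=> r a [i Ii Ji]; exists (r * i); first by apply: idealMl.
  by rewrite -mulrBr; apply: idealMl.
- move=> r a [i Ii Ji]; exists (i * r); first by apply: Defs.idealMr.
  by rewrite -mulrBl; apply: Defs.idealMr.
Qed.

Lemma ideal_sum_subl I J : two_sided_ideal J -> I `<=` ideal_sum I J.
Proof. by move=> JI i Ii; exists i => //; rewrite subrr; apply: ideal0. Qed.

Lemma ideal_sum_subr I J : two_sided_ideal I -> J `<=` ideal_sum I J.
Proof. by move=> II j Jj; exists 0; rewrite ?subr0//; apply: ideal0. Qed.

Lemma ideal_proper1 I : two_sided_ideal I -> I != setT -> ~ I 1.
Proof.
move=> II /eqP IT I1; apply: IT; apply/seteqP; split=> // a _.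
by rewrite -[a]mulr1; apply: idealMl.
Qed.

(** With S a singleton at 1 this yields maximal ideals, with S closed under
    sandwich products it yields prime ideals. *)
Lemma Zorn_ideal I (S : set A) : two_sided_ideal I -> I `&` S = set0 ->
  exists P, [/\ two_sided_ideal P, I `<=` P, P `&` S = set0 &
    forall K, two_sided_ideal K -> P `<=` K -> K `&` S = set0 -> K = P].
Proof.
move=> II IS0.
pose good X := [/\ two_sided_ideal X, I `<=` X & X `&` S = set0].
(* The union of the empty chain is empty, so the empty set has to count as
     good; it is not maximal, because it is strictly below I. *)
have [F FP Ftot|P [[P0|[PI IP PS0]] Pmax]] :=
    @Zorn_bigcup A [set X | X = set0 \/ good X].
- have [F0|/existsNP[X /not_implyP[FX X0]]] :=
    pselect (forall X, F X -> X = set0).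
    by left; rewrite -subset0 => a [X FX]; rewrite (F0 _ FX).
  have goodF Y a : F Y -> Y a -> good Y.
    by move=> FY Ya; case: (FP Y FY) => // Y0; rewrite Y0 in Ya.
  have [XI IX XS0] : good X by case: (FP X FX).
  right; split.
  + split.
    * by exists X => //; apply: ideal0.
    * move=> a b [Y FY Ya] [Z FZ Zb].
      have [YI _ _] := goodF _ _ FY Ya; have [ZI _ _] := goodF _ _ FZ Zb.
      case: (Ftot _ _ FY FZ) => [YZ|ZY].
        by exists Z => //; apply: idealB => //; apply: YZ.
      by exists Y => //; apply: idealB => //; apply: ZY.
    * move=> r a [Y FY Ya]; have [YI _ _] := goodF _ _ FY Ya.
      by exists Y => //; apply: idealMl.
    * move=> r a [Y FY Ya]; have [YI _ _] := goodF _ _ FY Ya.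
      by exists Y => //; apply: Defs.idealMr.
  + by move=> i Ii; exists X => //; apply: IX.
  + rewrite -subset0 => a [[Y FY Ya] Sa]; have [_ _ YS0] := goodF _ _ FY Ya.
    by rewrite -YS0.
- case: (Pmax I); last by right; split.
  rewrite P0; split; first exact: sub0set.
  by move/(_ 0 (ideal0 II)).
- exists P; split=> // K KI PK KS0; apply/eqP/negPn/negP => /eqP KP.
  apply: (Pmax K); last by right; split=> //; apply: subset_trans PK.
  by split=> // KsubP; apply: KP; apply/seteqP.
Qed.

Lemma ideal_sub_maximal I : two_sided_ideal I -> I != setT ->
  exists2 M, maximal_ideal M & I `<=` M.
Proof.
move=> II IT; have I1 := ideal_proper1 II IT.
have [|M [MI IM M1 Mmax]] := @Zorn_ideal I [set 1] II.
  by rewrite -subset0 => a [Ia a1]; apply: I1; rewrite -a1.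
exists M => //; split=> //.
  by apply/eqP => MT; have : (set0 : set A) 1 by rewrite -M1 MT; split.
move=> J JI MJ; have [->|JT] := eqVneq J setT; [by right|left].
apply: Mmax => //; rewrite -subset0 => a [Ja a1].
by apply: (ideal_proper1 JI JT); rewrite -a1.
Qed.

(** An ideal maximal among those disjoint from S is prime: two ideals not
    contained in P meet S modulo P in some s and t, and then s r t is, modulo P,
    a product of elements of these ideals. *)
Lemma prime_avoiding (S : set A) : S !=set0 -> ~ S 0 ->
  (forall s t, S s -> S t -> exists r, S (s * r * t)) ->
  exists2 P, prime_ideal P & P `&` S = set0.
Proof.
move=> [s0 Ss0] S0 Smul.
have ZI : two_sided_ideal [set 0 : A].
  split=> [//|a b -> ->|r a ->|r a ->] /=; by rewrite ?subr0 ?mulr0 ?mul0r.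
have [|P [PI _ PS0 Pmax]] := @Zorn_ideal _ S ZI.
  by rewrite -subset0 => a [-> /S0].
have nPS a : P a -> S a -> False.
  by move=> Pa Sa; rewrite -[False]/(set0 a) -PS0.
exists P => //; split=> //.
  by apply/eqP => PT; apply: (nPS s0) => //; rewrite PT.
have meetS K : two_sided_ideal K -> ~ K `<=` P ->
    exists s p, [/\ S s, P p & K (s - p)].
  move=> KI nKP; have PKI := two_sided_ideal_sum PI KI.
  have [PK0|/set0P[s [[p Pp Ks] Ss]]] := eqVneq (ideal_sum P K `&` S) set0.
    case: nKP; rewrite -(Pmax _ PKI _ PK0).
      exact: ideal_sum_subr.
    exact: ideal_sum_subl.
  by exists s, p.
move=> I J II JI IJP; apply: contrapT => /not_orP[nI nJ].
have [s [p [Ss Pp Is]]] := meetS I II nI.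
have [t [q [St Pq Jt]]] := meetS J JI nJ.
have [r Ssrt] := Smul s t Ss St; apply: nPS Ssrt.
have -> : s * r * t = (s - p) * r * (t - q) + (s - p) * r * q + p * r * t.
  by rewrite -mulrDr subrK -mulrDl -mulrDl subrK.
apply: idealD => //; last by apply: Defs.idealMr => //; apply: Defs.idealMr.
apply: idealD => //; last by apply: idealMl.
by apply: IJP => //; apply: Defs.idealMr.
Qed.

End Ideals.

(** * Implications valid for every ring *)

Section SpectrumTopology.
Variable A : pzRingType.
Implicit Types (P Q : Spec A) (I J : set A) (U : set (Spec A)).

Lemma spec_two_sided P : two_sided_ideal P.
Proof. exact: prime_two_sided (spec_prime P). Qed.

Lemma spec_eq P Q : P = Q :> set A -> P = Q.
Proof.
case: P Q => [P pP] [Q pQ] /= PQ; move: pP pQ; rewrite PQ => pP pQ.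
by rewrite (Prop_irrelevance pP pQ).
Qed.

Definition MaxPoint (M : set A) (MM : maximal_ideal M) : Spec A :=
  MkSpec (maximal_ideal_prime MM).

Lemma open_zariskiW I : two_sided_ideal I -> open (zariskiW I : set (Spec A)).
Proof. by move=> II; exists I. Qed.

Lemma closed_SpecP U : closed U ->
  exists2 I, two_sided_ideal I & U = [set P | I `<=` P].
Proof.
move=> /closed_openC[I II UI]; exists I => //.
rewrite -[LHS]setCK UI; apply/seteqP; split=> P /=.
  by move/contrapT.
by move=> IP; apply.
Qed.

Lemma closed_zariskiV I :
  two_sided_ideal I -> closed [set P : Spec A | I `<=` P].
Proof.
move=> II; rewrite -[X in closed X]setCK; apply: open_closedC.
exact: open_zariskiW.
Qed.

(** Going down along inclusions stays inside open sets: this is what makes a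
    prime ideal inseparable from the maximal ideals above it. *)
Lemma open_specialization U P Q : open U -> P `<=` Q -> U Q -> U P.
Proof.
by move=> [I II ->] PQ nIQ IP; apply: nIQ; apply: subset_trans PQ.
Qed.

Lemma maximal_sub_eq P Q : maximal_ideal P -> P `<=` Q -> Q = P.
Proof.
move=> MP PQ; apply: spec_eq.
have [//|QT] := maximal_idealP MP (spec_two_sided Q) PQ.
by have := prime_proper (spec_prime Q); rewrite QT eqxx.
Qed.

Lemma closed_Max_point P : maximal_ideal P -> closed [set P].
Proof.
move=> MP; have -> : [set P] = [set Q : Spec A | P `<=` Q].
  apply/seteqP; split=> Q /=; first by move=> ->.
  exact: maximal_sub_eq.
exact/closed_zariskiV/spec_two_sided.
Qed.

Lemma Max_valP (m : @Max A) : maximal_ideal (set_val m : Spec A).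
Proof. exact: set_mem (valP m). Qed.

Lemma Max_val_inj (m m' : @Max A) :
  (set_val m : Spec A) = (set_val m') -> m = m'.
Proof. by rewrite set_valE; apply: val_inj. Qed.

Lemma pm_of_unique :
  (forall P (m m' : @Max A), P `<=` (set_val m : Spec A) ->
     P `<=` (set_val m' : Spec A) -> m = m') -> pm_ring A.
Proof.
move=> uniqM P pP.
have [M MM PM] := ideal_sub_maximal (prime_two_sided pP) (prime_proper pP).
exists M; split=> // M' [MM' PM'].
have pt N (NN : maximal_ideal N) : Max (MaxPoint NN) by [].
have := uniqM (MkSpec pP) (SigSub (mem_set (pt _ MM)))
  (SigSub (mem_set (pt _ MM'))) PM PM'.
by move/(congr1 (fun m : @Max A => spec_ideal (set_val m))).
Qed.

Lemma normal_separate_Max : normal_space (Spec A) ->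
  forall m m' : @Max A, m <> m' -> exists U V, [/\ open U, open V,
    U (set_val m), V (set_val m') & U `&` V = set0].
Proof.
move=> /normal_disjoint_openP sep m m' mm'.
have [||/=|U [V [oU oV mU m'V UV0]]] :=
  sep [set (set_val m)] [set (set_val m')].
- exact/closed_Max_point/Max_valP.
- exact/closed_Max_point/Max_valP.
- by rewrite -subset0 => P [-> /Max_val_inj].
by exists U, V; split=> //; [apply: mU|apply: m'V].
Qed.

Lemma normal_Max_hausdorff :
  normal_space (Spec A) -> hausdorff_space (@Max A).
Proof.
move=> /normal_separate_Max sep; rewrite open_hausdorff => m m' /eqP mm'.
have [U [V [oU oV mU m'V UV0]]] := sep m m' mm'.
exists (set_val @^-1` U, set_val @^-1` V); first by rewrite !inE.
split; [by exists U|by exists V|].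
by apply/eqP; rewrite -preimage_setI UV0 preimage_set0.
Qed.

Lemma normal_pm : normal_space (Spec A) -> pm_ring A.
Proof.
move=> /normal_separate_Max sep; apply: pm_of_unique => P m m' Pm Pm'.
apply: contrapT => /sep[U [V [oU oV mU m'V UV0]]].
rewrite -[False]/(set0 P) -UV0; split.
- exact: open_specialization mU.
- exact: open_specialization m'V.
Qed.

(** The retraction r is continuous and r(M) = M, so r(P) lies in every
    neighbourhood of M in the maximal spectrum as soon as P is below M; since
    points of that space are closed, r(P) = M. *)
Lemma retract_pm : is_retract (@Max A) -> pm_ring A.
Proof.
move=> [r [/continuousP rc rid]].
have rP P (m : @Max A) : P `<=` (set_val m : Spec A) -> m = r P.
  move=> Pm; apply: contrapT => mr.
  pose I : set A := spec_ideal (set_val (r P)).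
  pose U : set (@Max A) := set_val @^-1` zariskiW I.
  have oU : open U.
    by exists (zariskiW I) => //; apply/open_zariskiW/spec_two_sided.
  have : (r @^-1` U) (set_val m).
    rewrite /U /= rid => Im; apply: mr; apply: Max_val_inj.
    by apply: maximal_sub_eq => //; apply: Max_valP.
  by move/(open_specialization (rc _ oU) Pm); apply.
by apply: pm_of_unique => P m m' Pm Pm'; rewrite (rP P m)// (rP P m').
Qed.

(** The retraction sends P to the unique maximal ideal above P. To see that it
    is continuous, separate the closed point r(P) from the closed complement of
    an open set W around it: a prime Q near r(P) cannot have r(Q) outside W,
    since Q lies in every open set that contains r(Q). *)
Lemma pm_normal_retract :
  pm_ring A -> normal_space (Spec A) -> is_retract (@Max A).
Proof.
move=> pmA /normal_disjoint_openP sep.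
have exM P : exists m : @Max A, P `<=` (set_val m : Spec A).
  have [M [[MM PM] _]] := pmA P (spec_prime P).
  have pt : Max (MaxPoint MM) by [].
  by exists (SigSub (mem_set pt)).
have uniqM P (m m' : @Max A) : P `<=` (set_val m : Spec A) ->
    P `<=` (set_val m' : Spec A) -> m = m'.
  move=> Pm Pm'; have [M [_ Mu]] := pmA P (spec_prime P).
  by apply/Max_val_inj/spec_eq; rewrite -(Mu (set_val m)) ?(Mu (set_val m'))//;
    split=> //; apply: Max_valP.
have [r rP] := choice exM.
exists r; split; last by move=> m; apply: (uniqM (set_val m)).
apply/continuousP => _ [W oW <-]; rewrite openE => P /= rPW.
have [||/=|U [V [oU oV rU WV UV0]]] := sep [set (set_val (r P))] (~` W).
- exact/closed_Max_point/Max_valP.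
- exact: open_closedC.
- by rewrite -subset0 => Q [->].
rewrite /interior nbhsE; exists U.
  split=> //; apply: open_specialization (rP P) _ => //; exact: rU.
move=> Q UQ /=; apply: contrapT => /WV VrQ.
rewrite -[False]/(set0 Q) -UV0; split=> //.
exact: open_specialization (rP Q) _.
Qed.

End SpectrumTopology.

(** * Reduced rings: pm implies normal *)

Definition reduced (A : pzRingType) : Prop := forall a : A, a * a = 0 -> a = 0.

Section Reduced.
Variable A : pzRingType.
Hypothesis redA : reduced A.
Implicit Types a b c d : A.

Lemma reduced_mulC0 a b : a * b = 0 -> b * a = 0.
Proof.
by move=> ab0; apply: redA; rewrite mulrA -(mulrA b) ab0 mulr0 mul0r.
Qed.

(** The square of arb contains the factor ba = 0. *)
Lemma reduced_insert0 r a b : a * b = 0 -> a * r * b = 0.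
Proof.
move=> ab0; apply: redA.
by rewrite !mulrA -(mulrA (a * r)) (reduced_mulC0 ab0) mulr0 !mul0r.
Qed.

(** Two adjacent factors of a vanishing product may be exchanged. For three
    factors, (xzy)(xzy) contains x, y and z in this order; the outer factor d is
    moved next to a by [reduced_mulC0]. *)
Lemma reduced_swap0 a b c d : a * b * c * d = 0 -> a * c * b * d = 0.
Proof.
have swap (x y z : A) : x * y * z = 0 -> x * z * y = 0.
  move=> xyz0; apply: redA; have h : x * z * y * x * z = 0.
    apply: reduced_insert0; rewrite -mulrA.
    by apply: reduced_insert0; rewrite mulrA.
  by rewrite mulrA mulrA h mul0r.
move=> /reduced_mulC0; rewrite !mulrA => /swap dacb0; apply: reduced_mulC0.
by rewrite !mulrA.
Qed.
End Reduced.

(** The elementwise form of primeness, obtained by replacing first a and then b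
    by an arbitrary element of the ideal it generates. *)
Lemma prime_ideal_mul (A : pzRingType) (P : set A) (a b : A) :
  prime_ideal P -> (forall r, P (a * r * b)) -> P a \/ P b.
Proof.
move=> pP aPb; have PI := prime_two_sided pP.
have [||u v uP vP|aP|bP] :=
  @prime_idealP _ _ pP (ideal_span [set a]) (ideal_span [set b]).
- exact: two_sided_ideal_span.
- exact: two_sided_ideal_span.
- pose K := [set u' | forall r, P (u' * r * b)].
  have KI : two_sided_ideal K.
    split=> [r|c d Kc Kd r|s c Kc r|s c Kc r] /=.
    + by rewrite !mul0r; apply: ideal0.
    + by rewrite !mulrBl; apply: idealB; [|apply: Kc|apply: Kd].
    + by rewrite -!mulrA; apply: idealMl => //; rewrite mulrA; apply: Kc.
    + by rewrite -(mulrA c); apply: Kc.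
  have Ku : K u by apply: uP => // _ ->.
  have LI : two_sided_ideal [set v' | forall r, P (u * r * v')].
    split=> [r|c d Lc Ld r|s c Lc r|s c Lc r] /=.
    + by rewrite mulr0; apply: ideal0.
    + by rewrite mulrBr; apply: idealB; [|apply: Lc|apply: Ld].
    + by rewrite mulrA -(mulrA u); apply: Lc.
    + by rewrite mulrA; apply: Defs.idealMr => //; apply: Lc.
  have /(_ 1) : [set v' | forall r, P (u * r * v')] v by apply: vP => // _ ->.
  by rewrite mulr1.
- by left; apply: aP => L _; apply.
- by right; apply: bP => L _; apply.
Qed.

Section PmNormal.
Variable A : pzRingType.
Hypothesis redA : reduced A.

(** The algebraic form of normality: W(a) contains V(I), W(b) contains V(J), and
    aAb = 0 makes W(a) and W(b) disjoint. *)
Lemma reduced_pm_separate (I J : set A) : pm_ring A ->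
  two_sided_ideal I -> two_sided_ideal J ->
  (forall P : Spec A, I `<=` P -> J `<=` P -> False) ->
  exists a b, [/\ I (1 - a), J (1 - b) & forall r, a * r * b = 0].
Proof.
move=> pmA II JI IJ.
have coset1M (K : set A) a b :
    two_sided_ideal K -> K (1 - a) -> K (1 - b) -> K (1 - a * b).
  move=> KI Ka Kb; have -> : 1 - a * b = (1 - a) + a * (1 - b).
    by rewrite mulrBr mulr1 addrA subrK.
  by apply: idealD => //; apply: idealMl.
(* Products ab alone are not closed under multiplication. Comparing right
   annihilators closes them up, and 0 is added only if some ab vanishes. *)
pose S : set A := [set s | exists a b,
  [/\ I (1 - a), J (1 - b) & forall y, s * y = 0 -> a * b * y = 0]].
have I0 := ideal0 II; have J0 := ideal0 JI.
have [[a [b [Ia Jb /(_ 1)]]]|nS0] := pselect (S 0).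
  rewrite mul0r mulr1 => /(_ erefl) ab0.
  by exists a, b; split=> // r; apply: reduced_insert0.
have [||P pP PS0] := @prime_avoiding A S _ nS0.
- by exists 1, 1, 1; rewrite !subrr mulr1; split.
- move=> s t [a [b [Ia Jb sab]]] [a' [b' [Ia' Jb' tab]]].
  exists 1, (a * a'), (b * b').
  split; [exact: coset1M|exact: coset1M|move=> y].
  rewrite mulr1 -(mulrA s) => /sab /(reduced_mulC0 redA).
  rewrite -(mulrA t) => /tab.
  rewrite (mulrA (a' * b')) => /(reduced_mulC0 redA).
  rewrite !mulrA => h; rewrite -(mulrA _ b' y).
  by apply: reduced_swap0 => //; rewrite mulrA.
have nPS s : P s -> S s -> False.
  by move=> Ps Ss; rewrite -[False]/(set0 s) -PS0.
have over K : two_sided_ideal K -> (forall p, P p -> K (1 - p) -> S p) ->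
    exists2 M, maximal_ideal M & P `<=` M /\ K `<=` M.
  move=> KI KS; have PI := prime_two_sided pP.
  have PKI := two_sided_ideal_sum PI KI.
  have [|M MM PKM] := ideal_sub_maximal PKI.
    apply/eqP => PKT; have [p Pp Kp] : ideal_sum P K 1 by rewrite PKT.
    exact: nPS (KS p Pp Kp).
  exists M => //; split; apply: subset_trans PKM.
    exact: ideal_sum_subl.
  exact: ideal_sum_subr.
(* If 1 = p + i with p in P and i in I, then p lies in 1+I, hence in S. *)
have [|M MM [PM IM]] := over I II.
  by move=> p _ Ip; exists p, 1; rewrite subrr mulr1; split.
have [|N NN [PN JN]] := over J JI.
  by move=> p _ Jp; exists 1, p; rewrite subrr mul1r; split.
have [Q [_ Quniq]] := pmA P pP.
case: (IJ (MkSpec (maximal_ideal_prime MM))) => //=.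
by rewrite -(Quniq M (conj MM PM)) (Quniq N (conj NN PN)).
Qed.

Lemma reduced_pm_normal : pm_ring A -> normal_space (Spec A).
Proof.
move=> pmA; apply/normal_disjoint_openP => C D.
move=> /closed_SpecP[I II ->] /closed_SpecP[J JI ->] IJ0.
have [P IP JP|a [b [Ia Jb ab0]]] := reduced_pm_separate pmA II JI.
  by rewrite -[False]/(set0 P) -IJ0.
have sep K c (P : Spec A) :
    K (1 - c) -> K `<=` P -> ~ ideal_span [set c] `<=` P.
  move=> Kc KP cP; apply: (ideal_proper1 (spec_two_sided P)).
    exact: prime_proper (spec_prime P).
  rewrite -[1](subrK c); apply: idealD; first exact: spec_two_sided.
    exact: KP.
  by apply: cP => L _; apply.
exists (zariskiW (ideal_span [set a])), (zariskiW (ideal_span [set b])).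
split; try exact/open_zariskiW/two_sided_ideal_span.
- by move=> P; apply: sep.
- by move=> P; apply: sep.
rewrite -subset0 => P [aP bP].
have span1 c : spec_ideal P c -> ideal_span [set c] `<=` P.
  by move=> Pc u; apply; [apply: spec_two_sided|move=> _ ->].
have [|/span1//|/span1//] := prime_ideal_mul (spec_prime P) (a := a) (b := b).
by move=> r; rewrite ab0; apply: ideal0; apply: spec_two_sided.
Qed.
End PmNormal.

(** * Baer Sigma-semicommutative coefficients *)

Section BaerCoefficients.
Variables (n : nat) (R : pzRingType) (sigma : 'I_n -> {rmorphism R -> R}).
Hypotheses (n_gt0 : (0 < n)%N) (semicommR : Sigma_semicommutative sigma).
Hypotheses (baerR : Baer R) (sigma_inj : forall i, injective (sigma i)).

Lemma sigma_pow1 (i : 'I_n) b :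
  sigma_pow sigma [ffun j => (j == i) : nat] b = sigma i b.
Proof.
rewrite /sigma_pow; have := mem_enum 'I_n i; have := enum_uniq 'I_n.
elim: (enum 'I_n) => //= j s IHs /andP[js us]; rewrite in_cons ffunE.
have [eij _|ij /(IHs us) <- //] := eqVneq i j.
subst j; congr (sigma _ _); elim: s js {us IHs} => //= k s IHs.
by rewrite in_cons negb_or => /andP[ik /IHs]; rewrite ffunE eq_sym (negPf ik).
Qed.

Implicit Types a b e r : R.

Lemma semicomm_sigma i a b r : a * b = 0 -> a * r * sigma i b = 0.
Proof.
move=> ab0; rewrite -sigma_pow1; apply: semicommR => //.
by apply/eqP => /ffunP/(_ i); rewrite !ffunE eqxx.
Qed.

Lemma idem_sigma i e : e * e = e -> sigma i e = e.
Proof.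
move=> ee; have e1 : e * (1 - e) = 0 by rewrite mulrBr mulr1 ee subrr.
have e2 : (1 - e) * e = 0 by rewrite mulrBl mul1r ee subrr.
have := semicomm_sigma i 1 e1; have := semicomm_sigma i 1 e2.
rewrite rmorphB rmorph1 !mulr1 mulrBr mulr1 mulrBl mul1r.
by move=> /subr0_eq e_es /subr0_eq s_es; rewrite e_es -s_es.
Qed.

(** As sigma_i fixes e, both eR(1-e) and (1-e)Re vanish. *)
Lemma idem_central e : e * e = e -> forall r, e * r = r * e.
Proof.
move=> ee r; pose i := Ordinal n_gt0.
have e1 : e * (1 - e) = 0 by rewrite mulrBr mulr1 ee subrr.
have e2 : (1 - e) * e = 0 by rewrite mulrBl mul1r ee subrr.
have := semicomm_sigma i r e2; have := semicomm_sigma i r e1.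
rewrite rmorphB rmorph1 idem_sigma// mulrBr mulr1 => /subr0_eq ->.
by rewrite mulrBl mul1r mulrBl => /subr0_eq ->.
Qed.

(** The generator of the annihilator, described by equations; the second one,
    taken at b = e, says that e is idempotent. *)
Lemma Baer_ann a : exists2 e, a * e = 0 & forall b, a * b = 0 -> e * b = b.
Proof.
have [|e ee /seteqP[annS annE]] := @baerR [set a]; first by exists a.
exists e; first by apply: (annE e) => //; exists 1; rewrite ?mulr1.
move=> b ab; have [|s _ <-] := annS b; first by move=> _ ->.
by rewrite mulrA ee.
Qed.

Lemma Baer_semicomm_reduced : reduced R.
Proof.
move=> a; have [e ae eP] := Baer_ann a.
by move=> /eP <-; rewrite (idem_central (eP _ ae)).
Qed.

Lemma sigma_cancel0 i a b : a * sigma i b = 0 -> a * b = 0.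
Proof.
have [e ae eP] := Baer_ann a.
have /(idem_sigma i) se := eP _ ae.
move=> /eP; rewrite -{1}se -rmorphM => /sigma_inj <-.
by rewrite mulrA ae mul0r.
Qed.

End BaerCoefficients.

(** * Left combinations of a family *)

Section LeftSpan.
Variables (R A : pzRingType) (iota : {rmorphism R -> A}).
Variables (T : eqType) (v : T -> A).
Implicit Types (D E : pred T) (a b : A).

(** Repetitions among the indices are allowed, so that sums are concatenations;
    [lspan_uniq] removes them. *)
Definition lspan D a : Prop := exists2 s : seq (R * T),
  all (fun p => D p.2) s & a = \sum_(p <- s) iota p.1 * v p.2.

Lemma lspan0 D : lspan D 0.
Proof. by exists [::]; rewrite ?big_nil. Qed.

Lemma lspanD D a b : lspan D a -> lspan D b -> lspan D (a + b).
Proof.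
move=> [s sD ->] [t tD ->]; exists (s ++ t); first by rewrite all_cat sD.
by rewrite big_cat.
Qed.

Lemma lspan_scale D r t : D t -> lspan D (iota r * v t).
Proof. by move=> Dt; exists [:: (r, t)]; rewrite ?big_seq1//= Dt. Qed.

Lemma lspan_ind D (K : A -> Prop) : K 0 ->
  (forall a b, K a -> K b -> K (a + b)) ->
  (forall r t, D t -> K (iota r * v t)) -> forall a, lspan D a -> K a.
Proof.
move=> K0 KD Kv a [s + ->]; elim: s => [|[r t] s IHs]; first by rewrite big_nil.
by move=> /= /andP[Dt /IHs Ks]; rewrite big_cons; apply: KD => //; apply: Kv.
Qed.

Lemma lspanM D r a : lspan D a -> lspan D (iota r * a).
Proof.
elim/lspan_ind => [|b c Db Dc|s t Dt]; first by rewrite mulr0; apply: lspan0.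
  by rewrite mulrDr; apply: lspanD.
by rewrite mulrA -rmorphM; apply: lspan_scale.
Qed.

Lemma lspanN D a : lspan D a -> lspan D (- a).
Proof. by move/(lspanM (-1)); rewrite rmorphN1 mulN1r. Qed.

Lemma lspanB D a b : lspan D a -> lspan D b -> lspan D (a - b).
Proof. by move=> Da /lspanN; apply: lspanD. Qed.

Lemma lspan_sub D E a : {subset D <= E} -> lspan D a -> lspan E a.
Proof.
by move=> DE [s sD ->]; exists s => //; apply: sub_all sD => p; apply: DE.
Qed.

Lemma lspan_uniq D a : lspan D a -> exists s (c : T -> R),
  [/\ uniq s, all D s, {in s, forall t, c t != 0} &
    a = \sum_(t <- s) iota (c t) * v t].
Proof.
move=> [s sD ->].
pose u := undup [seq p.2 | p <- s].
pose c t := \sum_(p <- s | p.2 == t) p.1.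
exists [seq t <- u | c t != 0], c; split.
- exact/filter_uniq/undup_uniq.
- apply/allP => t; rewrite mem_filter mem_undup => /andP[_ /mapP[p ps ->]].
  by move/allP: sD => /(_ p ps).
- by move=> t; rewrite mem_filter => /andP[].
rewrite big_filter [RHS]big_mkcond /=.
transitivity (\sum_(t <- u) \sum_(p <- s | p.2 == t) iota p.1 * v p.2).
  rewrite (exchange_big_dep xpredT) //= big_seq [RHS]big_seq.
  apply: eq_bigr => p ps.
  rewrite -big_filter (eq_filter (a2 := pred1 p.2)); last first.
    by move=> t; apply: eq_sym.
  by rewrite filter_pred1_uniq ?big_seq1 ?undup_uniq// mem_undup map_f.
apply: eq_bigr => t _.
have -> : \sum_(p <- s | p.2 == t) iota p.1 * v p.2 = iota (c t) * v t.
  by rewrite rmorph_sum mulr_suml; apply: eq_bigr => p /eqP ->.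
by case: eqP => [->|//]; rewrite rmorph0 mul0r.
Qed.

End LeftSpan.

(** * Words and exponents *)

Section Words.
Variables (n : nat).
Implicit Types (w : seq 'I_n) (alpha : {ffun 'I_n -> nat}).

Definition std_word alpha : seq 'I_n :=
  flatten [seq nseq (alpha i) i | i <- enum 'I_n].

Definition word_exp w : {ffun 'I_n -> nat} := [ffun i => count_mem i w].

Lemma count_std_word alpha i : count_mem i (std_word alpha) = alpha i.
Proof.
rewrite /std_word; have := mem_enum 'I_n i; have := enum_uniq 'I_n.
have noti k s : k \notin s ->
    count_mem k (flatten [seq nseq (alpha j) j | j <- s]) = 0%N.
  move=> ks; apply/count_memPn; apply: contra ks.
  by move=> /flatten_mapP[j js]; rewrite mem_nseq => /andP[_ /eqP ->].
elim: (enum 'I_n) => //= j s IHs /andP[js us].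
rewrite in_cons count_cat count_nseq /=.
have [->|_ /(IHs us) -> //] := eqVneq i j.
by rewrite mul1n noti ?addn0.
Qed.

Lemma word_expK w : perm_eq (std_word (word_exp w)) w.
Proof. by apply/allP => i _; rewrite /= count_std_word ffunE. Qed.

Definition ord_leq : rel 'I_n := fun i j => (i <= j)%N.

Lemma ord_leq_trans : transitive ord_leq.
Proof. by move=> j i k; apply: leq_trans. Qed.

Lemma std_word_sorted alpha : sorted ord_leq (std_word alpha).
Proof.
rewrite (sorted_pairwise ord_leq_trans) /std_word.
have : pairwise ord_leq (enum 'I_n).
  rewrite -(sorted_pairwise ord_leq_trans).
  by have := iota_sorted 0 n; rewrite -val_enum_ord sorted_map.
elim: (enum 'I_n) => //= i s IHs /andP[/allP is_ /IHs sP].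
rewrite pairwise_cat sP andbT; apply/andP; split.
  apply/allrelP => j k; rewrite mem_nseq => /andP[_ /eqP ->].
  by move=> /flatten_mapP[l /is_ il]; rewrite mem_nseq => /andP[_ /eqP ->].
elim: (alpha i) => //= k ->; rewrite andbT; apply/allP => j.
by rewrite mem_nseq => /andP[_ /eqP ->]; apply: leqnn.
Qed.

(** A sorted word is determined by the multiplicities of its letters. *)
Lemma sorted_std_word w : sorted ord_leq w -> std_word (word_exp w) = w.
Proof.
move=> ws; apply: (sorted_eq ord_leq_trans) (word_expK w) => //.
  by move=> i j; rewrite -eqn_leq => /eqP/val_inj.
exact: std_word_sorted.
Qed.

End Words.

(** * Leading terms for a weight filtration *)

Section PBWReduced.
Variables (n : nat) (R A : pzRingType).
Variables (iota : {rmorphism R -> A}) (x : 'I_n -> A).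
Variables (sigma : 'I_n -> {rmorphism R -> R}).
Variables (delta : 'I_n -> {additive R -> R}).
Hypotheses (pbwA : skew_PBW iota x) (pbw_sigma : pbw_data iota x sigma delta).
Hypothesis redR : reduced R.
Implicit Types (w u v : seq 'I_n) (r : R) (a b : A).
Implicit Types (alpha beta : {ffun 'I_n -> nat}).

Definition mon w : A := \prod_(i <- w) x i.

Lemma mon_cons i w : mon (i :: w) = x i * mon w.
Proof. exact: big_cons. Qed.

Lemma mon_cat u v : mon (u ++ v) = mon u * mon v.
Proof. exact: big_cat. Qed.

Lemma mon_std_word alpha : mon (std_word alpha) = std_mon x alpha.
Proof.
have -> : std_mon x alpha = \prod_(i <- enum 'I_n) x i ^+ alpha i.
  by rewrite /std_mon enumT [index_enum _]unlock.
rewrite /mon /std_word big_flatten big_map.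
by apply: eq_bigr => i _; rewrite big_nseq iter_mulr_1.
Qed.

Lemma mon_sorted w : sorted (@ord_leq n) w -> mon w = std_mon x (word_exp w).
Proof. by move=> /sorted_std_word ws; rewrite -mon_std_word ws. Qed.

Definition sigma_word w r : R := foldr (fun i => sigma i) r w.

(** Freeness of A over R, in the form in which leading coefficients are
    compared. *)
Lemma std_mon_free (D : pred {ffun 'I_n -> nat}) r alpha : ~~ D alpha ->
  lspan iota (std_mon x) D (iota r * std_mon x alpha) -> r = 0.
Proof.
move=> Da /lspan_uniq[s [c [us /allP sD _ E]]].
have as_ : alpha \notin s by apply: contra Da; apply: sD.
pose c' beta := if beta == alpha then r else - c beta.
have c'E : {in s, forall beta, c' beta = - c beta}.
  by move=> beta bs; rewrite /c' (negPf (memPn as_ _ bs)).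
have := pbw_free pbwA (s := alpha :: s) (c := c').
move=> /(_ _ _ alpha); rewrite {2}/c' eqxx; apply; rewrite ?mem_head //= ?as_//.
rewrite big_cons {1}/c' eqxx E big_seq [X in _ + X]big_seq.
rewrite -big_split big1// => beta bs.
by rewrite /= c'E// rmorphN mulNr subrr.
Qed.

Lemma linear_std a : lspan iota mon [pred w | (size w <= 1)%N] a ->
  lspan iota (std_mon x) [pred alpha | (size (std_word alpha) <= 1)%N] a.
Proof.
elim/lspan_ind => [|b c Db Dc|r w /= w1]; first exact: lspan0.
  exact: lspanD.
have ws : sorted (@ord_leq n) w by case: w w1 => [//|i []].
rewrite mon_sorted//; apply: lspan_scale => /=.
by rewrite sorted_std_word.
Qed.

Local Notation linear := (lspan iota mon [pred w | (size w <= 1)%N]).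

Lemma comm_linear i j : exists d, linear (x j * x i - iota d * (x i * x j)).
Proof.
have [d _ [r0 [r E]]] := pbw_comm pbwA i j.
exists d; rewrite mulrA E; apply: lspanD.
  rewrite -[iota r0]mulr1 -[1](_ : mon [::] = _); last exact: big_nil.
  exact: lspan_scale.
elim/big_ind: _ => [|b c|k _]; [exact: lspan0|exact: lspanD|].
rewrite -[x k](_ : mon [:: k] = _); last exact: big_seq1.
exact: lspan_scale.
Qed.

(** For i < j the monomial x_i x_j is a basis element, and rewriting it as
    d' (x_j x_i) + ... = d' d (x_i x_j) + ... forces d' d = 1. Then 1 - d d' is
    annihilated by d on the right, hence by d' d = 1, because R is reduced. *)
Lemma comm_unit (i j : 'I_n) : (i < j)%N ->
  exists d d', [/\ d * d' = 1, d' * d = 1,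
  linear (x j * x i - iota d * (x i * x j)) &
  linear (x i * x j - iota d' * (x j * x i))].
Proof.
move=> ij; have [d dL] := comm_linear i j; have [d' d'L] := comm_linear j i.
have d'd : d' * d = 1.
  apply/esym/subr0_eq.
  have ijs : sorted (@ord_leq n) [:: i; j] by rewrite /= /ord_leq ltnW.
  apply: (@std_mon_free [pred alpha | (size (std_word alpha) <= 1)%N] _
    (word_exp [:: i; j])); first by rewrite /= sorted_std_word.
  rewrite -mon_sorted//; apply: linear_std.
  have -> : iota (1 - d' * d) * mon [:: i; j] =
     (x i * x j - iota d' * (x j * x i)) +
       iota d' * (x j * x i - iota d * (x i * x j)).
    rewrite mon_cons -[mon [:: j]](_ : x j = _); last by rewrite /mon big_seq1.
    by rewrite rmorphB rmorph1 rmorphM mulrBl mul1r mulrBr addrA subrK mulrA.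
  by apply: lspanD => //; apply: lspanM.
have dd' : d * d' = 1.
  have ed : (1 - d * d') * d = 0 by rewrite mulrBl mul1r -mulrA d'd mulr1 subrr.
  apply/esym/subr0_eq; rewrite -[LHS]mulr1 -[X in _ * X]d'd mulrA.
  exact: reduced_insert0.
by exists d, d'; split.
Qed.

Section Weights.
Variable omega : 'I_n -> nat.
Hypothesis omega_gt0 : forall i, (0 < omega i)%N.
(* The terms r_0 + r_1 x_1 + ... + r_n x_n of a commutation relation are then of
   smaller weight than the quadratic ones. *)
Hypothesis omega_quad : forall i j k, (omega k < omega i + omega j)%N.

Definition wt w : nat := (\sum_(i <- w) omega i)%N.

Lemma wt_cons i w : wt (i :: w) = (omega i + wt w)%N.
Proof. exact: big_cons. Qed.

Lemma wt_cat u v : wt (u ++ v) = (wt u + wt v)%N.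
Proof. exact: big_cat. Qed.

(** Combinations of arbitrary words, not only of sorted ones: this makes the
    filtration visibly multiplicative, before anything is known about
    reordering. *)
Definition lower d := lspan iota mon [pred w | (wt w < d)%N].

Lemma lower_le d e a : (d <= e)%N -> lower d a -> lower e a.
Proof. by move=> de; apply: lspan_sub => w /leq_trans; apply. Qed.

Lemma lower_x i d a : lower d a -> lower (omega i + d) (x i * a).
Proof.
elim/lspan_ind => [|b c Db Dc|r w /= wd].
- by rewrite mulr0; apply: lspan0.
- by rewrite mulrDr; apply: lspanD.
rewrite mulrA (pbw_dataE pbw_sigma) mulrDl -mulrA -mon_cons.
apply: lspanD; apply: lspan_scale => /=.
  by rewrite wt_cons ltn_add2l.
exact: ltn_addl.
Qed.

Lemma lower_monl w d a : lower d a -> lower (wt w + d) (mon w * a).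
Proof.
move=> da; elim: w => [|i w IHw]; first by rewrite /wt /mon !big_nil mul1r.
by rewrite mon_cons wt_cons -mulrA -addnA; apply: lower_x.
Qed.

Lemma lower_monr w d a : lower d a -> lower (d + wt w) (a * mon w).
Proof.
elim/lspan_ind => [|b c Db Dc|r v /= vd].
- by rewrite mul0r; apply: lspan0.
- by rewrite mulrDl; apply: lspanD.
by rewrite -mulrA -mon_cat; apply: lspan_scale; rewrite /= wt_cat ltn_add2r.
Qed.

Lemma mon_scalar w r :
  lower (wt w) (mon w * iota r - iota (sigma_word w r) * mon w).
Proof.
elim: w => [|i w IHw].
  by rewrite /mon !big_nil mul1r mulr1 subrr; apply: lspan0.
rewrite mon_cons wt_cons /=; set s := sigma_word w r.
have -> : x i * mon w * iota r - iota (sigma i s) * (x i * mon w) =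
    x i * (mon w * iota r - iota s * mon w) + iota (delta i s) * mon w.
  by rewrite mulrBr !mulrA (pbw_dataE pbw_sigma) mulrDl opprD addrA subrK.
apply: lspanD; first exact: lower_x.
by apply: lspan_scale; rewrite /= -[ltnLHS]add0n ltn_add2r.
Qed.

Lemma lower_scalr d r a : lower d a -> lower d (a * iota r).
Proof.
elim/lspan_ind => [|b c Db Dc|s w /= wd].
- by rewrite mul0r; apply: lspan0.
- by rewrite mulrDl; apply: lspanD.
rewrite -mulrA -[mon w * _](subrK (iota (sigma_word w r) * mon w)).
apply: lspanM; apply: lspanD; last exact: lspan_scale.
exact: lower_le (ltnW wd) (mon_scalar w r).
Qed.

Lemma lowerM d e a b : lower d a -> lower e b -> lower (d + e) (a * b).
Proof.
move=> + eb; elim/lspan_ind => [|c c' Dc Dc'|r w /= wd].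
- by rewrite mul0r; apply: lspan0.
- by rewrite mulrDl; apply: lspanD.
rewrite -mulrA; apply: lspanM; apply: lower_le (lower_monl w eb).
by rewrite leq_add2r ltnW.
Qed.

Lemma linear_lower i j a : linear a -> lower (omega i + omega j) a.
Proof.
apply: lspan_sub => -[|k []] //= _; rewrite inE /wt ?big_nil ?big_seq1.
  by rewrite addn_gt0 omega_gt0.
exact: omega_quad.
Qed.

(** Equality of leading terms up to a factor d from R. A right inverse of d is
    enough, since d is only cancelled from the right of a coefficient. *)
Definition same_lead u v : Prop := wt u = wt v /\ exists d d',
  d * d' = 1 /\ lower (wt u) (mon u - iota d * mon v).

Lemma same_lead_refl w : same_lead w w.
Proof.
split=> //; exists 1, 1; rewrite mulr1 rmorph1 mul1r subrr; split=> //.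
exact: lspan0.
Qed.

Lemma same_lead_trans u v w : same_lead u v -> same_lead v w -> same_lead u w.
Proof.
move=> [uv [d [d' [dd' uL]]]] [vw [e [e' [ee' vL]]]].
split; first by rewrite uv.
exists (d * e), (e' * d'); rewrite mulrA -(mulrA d) ee' mulr1; split=> //.
rewrite -[mon u](subrK (iota d * mon v)) rmorphM -mulrA -addrA -mulrBr.
by apply: lspanD => //; apply: lspanM; rewrite uv.
Qed.

Lemma same_lead_cons i u v : same_lead u v -> same_lead (i :: u) (i :: v).
Proof.
move=> [uv [d [d' [dd' uL]]]]; split; first by rewrite !wt_cons uv.
exists (sigma i d), (sigma i d'); rewrite -rmorphM dd' rmorph1; split=> //.
rewrite !mon_cons wt_cons.
have -> : x i * mon u - iota (sigma i d) * (x i * mon v) =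
    x i * (mon u - iota d * mon v) + iota (delta i d) * mon v.
  by rewrite mulrBr !mulrA (pbw_dataE pbw_sigma) mulrDl opprD addrA subrK.
apply: lspanD; first exact: lower_x.
by apply: lspan_scale; rewrite /= -uv -[ltnLHS]add0n ltn_add2r.
Qed.

Lemma same_lead_swap i j w : same_lead [:: i, j & w] [:: j, i & w].
Proof.
split; first by rewrite !wt_cons addnCA.
have lift d : linear (x i * x j - iota d * (x j * x i)) ->
    lower (wt [:: i, j & w]) (mon [:: i, j & w] - iota d * mon [:: j, i & w]).
  move/(linear_lower i j)/(lower_monr w).
  by rewrite !mon_cons !wt_cons mulrBl !mulrA addnA.
case: (ltngtP i j) => [ij|ji|/val_inj ->].
- by have [d [d' [dd' d'd _ /lift]]] := comm_unit ij; exists d', d.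
- by have [d [d' [dd' d'd /lift]]] := comm_unit ji; exists d, d'.
- by have [] := same_lead_refl [:: j, j & w].
Qed.

Lemma same_lead_insert i u v : same_lead (i :: u ++ v) (u ++ i :: v).
Proof.
elim: u => [|j u IHu] /=; first exact: same_lead_refl.
exact: same_lead_trans (same_lead_swap i j _) (same_lead_cons j IHu).
Qed.

Lemma perm_same_lead u v : perm_eq u v -> same_lead u v.
Proof.
elim: u v => [|i u IHu] v.
  by move/perm_size/esym/size0nil ->; apply: same_lead_refl.
move=> uv; have iv : i \in v by rewrite -(perm_mem uv) mem_head.
case/splitPr: iv uv => v1 v2 uv.
apply: same_lead_trans (same_lead_insert i v1 v2); apply/same_lead_cons/IHu.
by rewrite -(perm_cons i) (perm_trans uv)// -cat1s perm_catCA.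
Qed.

(** Induction on the weight: a word is a multiple of the standard monomial with
    the same letters, up to words of smaller weight. *)
Lemma lower_std d a : lower d a ->
  lspan iota (std_mon x) [pred alpha | (wt (std_word alpha) < d)%N] a.
Proof.
elim: d a => [|d IHd] a.
  elim/lspan_ind => [|b c Db Dc|r w //]; first exact: lspan0.
  exact: lspanD.
elim/lspan_ind => [|b c Db Dc|r w /= wd]; first exact: lspan0.
  exact: lspanD.
apply: lspanM; have [ww [e [_ [_ wL]]]] : same_lead w (std_word (word_exp w)).
  by apply: perm_same_lead; rewrite perm_sym word_expK.
rewrite -[mon w](subrK (iota e * mon (std_word (word_exp w)))).
apply: lspanD; last by rewrite mon_std_word; apply: lspan_scale; rewrite /= -ww.
apply: (@lspan_sub _ _ _ _ _ [pred alpha | (wt (std_word alpha) < d)%N]).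
  by move=> alpha; rewrite !inE => /ltnW.
exact/IHd/(lower_le _ wL).
Qed.

Lemma lower_free r w : lower (wt w) (iota r * mon w) -> r = 0.
Proof.
have [ww [d [d' [dd' wL]]]] : same_lead w (std_word (word_exp w)).
  by apply: perm_same_lead; rewrite perm_sym word_expK.
move=> /lspanB/(_ (lspanM r wL)).
rewrite -mulrBr opprB addrC subrK mulrA -rmorphM mon_std_word => /lower_std.
move=> /std_mon_free; rewrite /= -ww ltnn => /(_ isT) rd.
by rewrite -[r]mulr1 -dd' mulrA rd mul0r.
Qed.

(** The coefficient of the word ww in the square is r sigma_w(r); all other
    contributions have weight less than that of ww. *)
Lemma sqr_lead r w a : lower (wt w) a ->
  (iota r * mon w + a) * (iota r * mon w + a) = 0 -> r * sigma_word w r = 0.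
Proof.
set s := sigma_word w r; move=> aL sq0; apply: (@lower_free _ (w ++ w)).
have -> : iota (r * s) * mon (w ++ w) =
  - (iota r * (mon w * iota r - iota s * mon w) * mon w
   + (iota r * mon w * a + a * iota r * mon w + a * a)).
  apply/eqP; rewrite -addr_eq0 -[X in _ == X]sq0; apply/eqP.
  rewrite mulrBr mulrBl mon_cat rmorphM !mulrA addrA [X in X + _]addrC subrK.
  by rewrite mulrDl !mulrDr !mulrA !addrA.
rewrite wt_cat; apply: lspanN; apply: lspanD; last first.
  apply: lspanD; last exact: lowerM.
  apply: lspanD; last by apply: lower_monr; apply: lower_scalr.
  by rewrite -mulrA; apply: lspanM; apply: lower_monl.
by apply: lower_monr; apply: lspanM; apply: mon_scalar.
Qed.

End Weights.
End PBWReduced.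

(** * Weights separating finitely many exponents *)

(** Uniqueness of base N expansions, with an unbounded top digit. *)
Lemma digits_inj N n (a b : 'I_n -> nat) s t :
  (forall i, a i < N)%N -> (forall i, b i < N)%N ->
  (\sum_i a i * N ^ i + s * N ^ n = \sum_i b i * N ^ i + t * N ^ n)%N ->
  a =1 b.
Proof.
elim: n a b => [a b _ _ _ []//|n IHn] a b aN bN.
have shift (c : 'I_n.+1 -> nat) m : (\sum_i c i * N ^ i + m * N ^ n.+1 =
    (\sum_i c (lift ord0 i) * N ^ i + m * N ^ n) * N + c ord0)%N.
  rewrite big_ord_recl expn0 muln1 -addnA addnC mulnDl big_distrl expnSr mulnA.
  by congr (_ + _ + _)%N; apply: eq_bigr => i _; rewrite /= -mulnA -expnSr.
have N0 : (0 < N)%N by apply: leq_ltn_trans (aN ord0).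
rewrite !shift => E.
have E0 : a ord0 = b ord0.
  by have := congr1 (modn^~ N) E; rewrite /= !modnMDl !modn_small.
move: E; rewrite E0 => /addIn/eqP; rewrite eqn_pmul2r// => /eqP/IHn E.
move=> i; case: (unliftP ord0 i) => [j ->|-> //].
by apply: E.
Qed.

Section Weight.
Variables (n N : nat).
Implicit Types (alpha beta : {ffun 'I_n -> nat}).

(** With N above all entries, the weight of an exponent is the number whose base
    N digits are its entries, topped by its total degree. *)
Definition deglex_weight (i : 'I_n) : nat := (N ^ n + N ^ i)%N.

Lemma deglex_weight_quad i j k : (0 < N)%N ->
  (deglex_weight k < deglex_weight i + deglex_weight j)%N.
Proof.
move=> N0; rewrite /deglex_weight addnACA.
apply: (@leq_ltn_trans (N ^ n + N ^ n)).
  by rewrite leq_add2l leq_pexp2l// ltnW.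
by rewrite -[ltnLHS]addn0 ltn_add2l addn_gt0 expn_gt0 N0.
Qed.

Lemma wt_std_word alpha :
  wt deglex_weight (std_word alpha) =
  (\sum_i alpha i * N ^ i + (\sum_i alpha i) * N ^ n)%N.
Proof.
rewrite /wt /std_word big_flatten big_map big_enum /= big_distrl -big_split.
apply: eq_bigr => i _; rewrite big_nseq iter_addn_0 mulnC mulnDr.
exact: addnC.
Qed.

Lemma deglex_weight_inj alpha beta :
  (forall i, alpha i < N)%N -> (forall i, beta i < N)%N ->
  wt deglex_weight (std_word alpha) = wt deglex_weight (std_word beta) ->
  alpha = beta.
Proof.
by rewrite !wt_std_word => aN bN /(digits_inj aN bN) ab; apply/ffunP.
Qed.
End Weight.

Lemma seq_argmax (T : eqType) (s : seq T) (f : T -> nat) : s != [::] ->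
  exists2 t, t \in s & forall u, u \in s -> (f u <= f t)%N.
Proof.
elim: s => //= t [|t' s] IHs _.
  by exists t; rewrite ?mem_head// => u; rewrite inE => /eqP ->.
have [//|m ms mP] := IHs; have [tm|mt] := leqP (f t) (f m).
  exists m; first by rewrite inE ms orbT.
  by move=> u; rewrite inE => /predU1P[->//|/mP].
exists t; first exact: mem_head.
by move=> u; rewrite inE => /predU1P[->//|/mP/leq_trans]; apply; apply: ltnW.
Qed.

(** * Skew PBW extensions are reduced *)

Section SkewPBWReduced.
Variables (n : nat) (R A : pzRingType).
Variables (iota : {rmorphism R -> A}) (x : 'I_n -> A).
Variables (sigma : 'I_n -> {rmorphism R -> R}).
Variables (delta : 'I_n -> {additive R -> R}).
Hypotheses (pbwA : skew_PBW iota x) (pbw_sigma : pbw_data iota x sigma delta).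
Hypothesis redR : reduced R.
Hypothesis sigma_cancel : forall i a b, a * sigma i b = 0 -> a * b = 0.

Lemma sigma_word_cancel w a b : a * sigma_word sigma w b = 0 -> a * b = 0.
Proof. by elim: w => //= i w IHw /sigma_cancel/IHw. Qed.

Theorem skew_PBW_reduced : reduced A.
Proof.
move=> f ff0.
have [s [c [us _ c0 fE]]] : exists s (c : {ffun 'I_n -> nat} -> R),
    [/\ uniq s, all xpredT s, {in s, forall alpha, c alpha != 0} &
      f = \sum_(alpha <- s) iota (c alpha) * std_mon x alpha].
  apply: lspan_uniq; have [s [c ->]] := pbw_span pbwA f.
  elim/big_ind: _ => [|b d|alpha _]; [exact: lspan0|exact: lspanD|].
  exact: lspan_scale.
have [s0|s0] := eqVneq s [::]; first by rewrite fE s0 big_nil.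
pose N := (\max_(alpha <- s) \max_i alpha i).+1.
have sN alpha : alpha \in s -> forall i, (alpha i < N)%N.
  move=> als i; rewrite ltnS; apply: leq_trans (leq_bigmax_seq _ als _) => //.
  exact: leq_bigmax.
pose omega := @deglex_weight n N.
have omega_gt0 i : (0 < omega i)%N by rewrite addn_gt0 expn_gt0.
have omega_quad i j k : (omega k < omega i + omega j)%N.
  exact: deglex_weight_quad.
have [alpha als amax] := seq_argmax (fun alpha => wt omega (std_word alpha)) s0.
(* The heaviest coefficient is nonzero by the choice of s, but it squares to
   zero. *)
have /eqP[] := c0 _ als; apply: redR.
apply: (@sigma_word_cancel (std_word alpha)).
pose g := \sum_(beta <- rem alpha s) iota (c beta) * std_mon x beta.
have {}fE : f = iota (c alpha) * mon x (std_word alpha) + g.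
  by rewrite fE (perm_big _ (perm_to_rem als)) big_cons mon_std_word.
apply: (sqr_lead (a := g) pbwA pbw_sigma redR omega_gt0 omega_quad); last first.
  by rewrite -fE.
rewrite /g big_seq.
elim/big_ind: _ => [|b d|beta]; [exact: lspan0|exact: lspanD|].
rewrite mem_rem_uniq// => /andP[/= ba bs].
rewrite -mon_std_word; apply: lspan_scale; rewrite /= ltn_neqAle amax// andbT.
by apply: contra ba => /eqP/deglex_weight_inj ->//; apply: sN.
Qed.

End SkewPBWReduced.

Theorem proposition5p2 (n : nat) (R A : pzRingType)
    (iota : {rmorphism R -> A}) (x : 'I_n -> A)
    (sigma : 'I_n -> {rmorphism R -> R}) (delta : 'I_n -> {additive R -> R})
    (n_gt0 : (0 < n)%N)
    (pbwA : skew_PBW iota x)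
    (pbw_sigma : pbw_data iota x sigma delta)
    (semicommR : Sigma_semicommutative sigma)
    (baerR : Baer R) :
  [/\ pm_ring A <-> is_retract (@Max A),
      is_retract (@Max A) <-> normal_space (Spec A) &
      normal_space (Spec A) -> hausdorff_space (@Max A)].
Proof.
have redR : reduced R := Baer_semicomm_reduced n_gt0 semicommR baerR.
have redA : reduced A.
  apply: (skew_PBW_reduced pbwA pbw_sigma redR) => i.
  exact: sigma_cancel0 semicommR baerR (sigma_inj pbw_sigma) i.
have pm_normal := @reduced_pm_normal A redA.
split; last exact: normal_Max_hausdorff.
- split; last exact: retract_pm.
  by move=> pmA; apply: pm_normal_retract => //; apply: pm_normal.
- split; first by move/retract_pm/pm_normal.
  by move=> nA; apply: pm_normal_retract => //; apply: normal_pm.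
Qed.
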